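(* Let $n\geq3$. Consider the thin Schubert cells $\mathbb{F}_{\mathbf{M}}$ of $\mathbb{F}_{1<n-1}(\mathbb{C}^n)$, indexed by the plurimatroids $\mathbf{M}\in\mathcal{M}^{1,n-1}_n$, and let $C$, $P$, $E$ be the sets of those $\mathbb{F}_{\mathbf{M}}$ that are complete, proper and empty, respectively (cells being counted by their index $\mathbf{M}$). Then: (1) $|C|=3^n-2^{n+1}+1$. (2) $|P|=4^n-3^n-n\cdot3^{n-1}$. (3) $|E|=n\cdot3^{n-1}$.
   Context: $[n]=\{1,\dots,n\}$ and $\binom{[n]}{d}$ is the set of $d$-element subsets of $[n]$. A matroid of rank $d$ on $n$ elements is a pair $M=([n],\mathcal{B})$ with $\emptyset\neq\mathcal{B}\subset\binom{[n]}{d}$ such that for all $I,J\in\mathcal{B}$ and $i\in I\setminus J$ there is $j\in J\setminus I$ with $(I\setminus\{i\})\cup\{j\}\in\mathcal{B}$. $\mathcal{M}^d_n$ is the set of such matroids and $\mathcal{M}^{1,n-1}_n=\mathcal{M}^1_n\times\mathcal{M}^{n-1}_n$; its elements are called plurimatroids. $G(d,n)$ is the Grassmannian of $d$-dimensional subspaces of $\mathbb{C}^n$ with Plücker coordinates $(p_I)$; for $M=([n],\mathcal{B})\in\mathcal{M}^d_n$, $G_M=\{W\in G(d,n):p_I(W)\neq0\Leftrightarrow I\in\mathcal{B}\}$. $\mathbb{F}_{1<n-1}(\mathbb{C}^n)=\{(W_1,W_2)\in G(1,n)\times G(n-1,n):W_1\subset W_2\}$ and, for $\mathbf{M}=(M_1,M_2)$,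 $\mathbb{F}_{\mathbf{M}}=(G_{M_1}\times G_{M_2})\cap\mathbb{F}_{1<n-1}(\mathbb{C}^n)$. The cell $\mathbb{F}_{\mathbf{M}}$ is called complete if $\mathbb{F}_{\mathbf{M}}=G_{M_1}\times G_{M_2}$, and proper if it is nonempty and $\mathbb{F}_{\mathbf{M}}\subsetneq G_{M_1}\times G_{M_2}$. *)

(* Defs.v *)
From HB Require Import structures.
From mathcomp Require Import all_boot all_algebra.
From mathcomp Require Import boolp classical_sets.

Set Implicit Arguments.
Unset Strict Implicit.
Unset Printing Implicit Defensive.

Import GRing.Theory.
Local Open Scope ring_scope.

Definition is_matroid (d n : nat) (B : {set {set 'I_n}}) : bool :=
  [&& B != finset.set0,
      [forall I in B, #|I| == d] &
      [forall I in B, forall J in B, forall i in I :\: J,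
         exists j in J :\: I, j |: (I :\ i) \in B]].

Record matroid (d n : nat) := Matroid {
  bases : {set {set 'I_n}};
  _ : is_matroid d bases
}.
HB.instance Definition _ (d n : nat) := [isSub for @bases d n].
HB.instance Definition _ (d n : nat) := [Finite of matroid d n by <:].

Definition plurimatroid (n : nat) : finType :=
  (matroid 1 n * matroid n.-1 n)%type.

(* The maximal minor, on the columns in I, of the matrix whose rows are the
   vectors of b; meaningful when size b = #|I|. *)
Definition minor (F : fieldType) (n : nat) (b : seq 'rV[F]_n) (I : {set 'I_n})
    : F :=
  \det (\matrix_(i < #|I|, j < #|I|) b`_i 0 (enum_val j)).

(* Homogeneous coordinates: computed from one fixed basis of W; any other basis
   rescales them by a common nonzero factor, see [plucker_basis]. *)
Definition plucker (F : fieldType) (n : nat) (W : {vspace 'rV[F]_n})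
    (I : {set 'I_n}) : F :=
  minor (vbasis W) I.

Lemma plucker_basis (F : fieldType) (n : nat) (W : {vspace 'rV[F]_n})
    (b : (\dim W).-tuple 'rV[F]_n) :
  basis_of W b ->
  exists2 c : F, c != 0 &
    forall I : {set 'I_n}, #|I| = \dim W -> minor b I = c * plucker W I.
Proof.
move=> bW; have vW := vbasisP W.
have change (b1 b2 : (\dim W).-tuple 'rV[F]_n) : basis_of W b1 ->
    basis_of W b2 -> forall i : 'I_(\dim W),
    b1`_i = \sum_(j < \dim W) coord b2 j b1`_i *: b2`_j.
  move=> B1 B2 i; apply: coord_span; rewrite (span_basis B2).
  by apply: (basis_mem B1); rewrite mem_nth // size_tuple.
pose M (b1 b2 : (\dim W).-tuple 'rV[F]_n) :=
  \matrix_(i < \dim W, j < \dim W) coord b2 j b1`_i.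
have MM : M b (vbasis W) *m M (vbasis W) b = 1%:M.
  apply/matrixP => i k; rewrite !mxE.
  have -> : (i == k)%:R = coord b k b`_i :> F.
    by rewrite coord_free ?(basis_free bW) // eq_sym.
  rewrite [in RHS](change _ _ bW vW i) linear_sum /=.
  by apply: eq_bigr => j _; rewrite !mxE linearZ.
have cN0 : \det (M b (vbasis W)) != 0.
  apply/eqP => d0; have := congr1 (fun A => \det A) MM.
  by rewrite det_mulmx d0 mul0r det1 => /eqP; rewrite eq_sym oner_eq0.
exists (\det (M b (vbasis W))) => // I dI.
have gen m (f : 'I_m -> 'I_n) : m = \dim W ->
    \det (\matrix_(i < m, j < m) b`_i 0 (f j)) =
    \det (M b (vbasis W)) * \det (\matrix_(i < m, j < m) (vbasis W)`_i 0 (f j)).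
  move=> mE; move: f; rewrite mE => f.
  rewrite -det_mulmx; congr (\det _); apply/matrixP => i j.
  rewrite !mxE [in LHS](change _ _ bW vW i) summxE.
  by apply: eq_bigr => k _; rewrite !mxE.
exact: gen.
Qed.

Local Open Scope classical_set_scope.

Definition grassmannian (F : fieldType) (d n : nat) : set {vspace 'rV[F]_n} :=
  [set W | \dim W = d].
Arguments grassmannian F d n : clear implicits.

Definition thin_schubert_cell (F : fieldType) (d n : nat) (M : matroid d n)
    : set {vspace 'rV[F]_n} :=
  [set W | grassmannian F d n W /\
    forall I : {set 'I_n}, #|I| = d -> plucker W I != 0 <-> I \in bases M].
Arguments thin_schubert_cell F {d n} M.

Definition flag_variety (F : fieldType) (n : nat)
    : set ({vspace 'rV[F]_n} * {vspace 'rV[F]_n}) :=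
  [set W | [/\ grassmannian F 1 n W.1, grassmannian F n.-1 n W.2
             & (W.1 <= W.2)%VS]].
Arguments flag_variety F n : clear implicits.

Definition cell_product (F : fieldType) (n : nat) (M : plurimatroid n)
    : set ({vspace 'rV[F]_n} * {vspace 'rV[F]_n}) :=
  thin_schubert_cell F M.1 `*` thin_schubert_cell F M.2.
Arguments cell_product F {n} M.

Definition flag_cell (F : fieldType) (n : nat) (M : plurimatroid n)
    : set ({vspace 'rV[F]_n} * {vspace 'rV[F]_n}) :=
  cell_product F M `&` flag_variety F n.
Arguments flag_cell F {n} M.

Definition complete_cell (F : fieldType) (n : nat) (M : plurimatroid n) : Prop :=
  flag_cell F M = cell_product F M.

Definition proper_cell (F : fieldType) (n : nat) (M : plurimatroid n) : Prop :=
  flag_cell F M !=set0 /\ flag_cell F M `<` cell_product F M.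

Definition empty_cell (F : fieldType) (n : nat) (M : plurimatroid n) : Prop :=
  flag_cell F M = set0.

(* Main.v *)
(** A matroid of rank 1 is a nonempty set S (its non-loops) and a matroid of rank
    n-1 is a nonempty set T (its non-coloops).  A line spanned by w lies in the
    first cell iff w has support S; a hyperplane lies in the second iff it is the
    kernel of a linear form a with support T, i.e. iff T is the set of those i for
    which it misses the basis vector e_i.  The flag condition is the incidence
    equation [sum_i w_i a_i = 0], whose nonzero terms are indexed by the
    intersection of S and T: it always holds if the intersection is empty, never
    if it is a singleton, and sometimes otherwise.  It remains to count pairs of
    nonempty sets by the size of their intersection. *)

Require Import Defs.
From mathcomp Require Import all_boot all_algebra.
From mathcomp Require Import boolp classical_sets reals complex.

Set Implicit Arguments.
Unset Strict Implicit.
Unset Printing Implicit Defensive.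

Import GRing.Theory Num.Theory.
Local Open Scope ring_scope.

(** * Vanishing of Plücker coordinates *)

Lemma plucker_neq0P (F : fieldType) (n : nat) (W : {vspace 'rV[F]_n})
    (I : {set 'I_n}) : #|I| = \dim W ->
  reflect (forall v, v \in W -> {in I, forall i, v 0 i = 0} -> v = 0)
          (plucker W I != 0).
Proof.
move=> cardI; rewrite /plucker /minor.
pose b : #|I|.-tuple 'rV[F]_n := tcast (esym cardI) (vbasis W).
have bE : tval b = vbasis W by rewrite val_tcast.
rewrite -bE; have bW : basis_of W b by rewrite bE vbasisP.
(* [A] is the matrix of the restriction map from [W] to the coordinates in [I]. Both sides have the
   same dimension, so [\det A] is nonzero exactly when this map is injective. *)
set A := \matrix_(i, j) _.
have AE (c : 'rV_#|I|) j :
    (c *m A) 0 j = (\sum_(i < #|I|) c 0 i *: b`_i) 0 (enum_val j).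
  by rewrite !mxE summxE; apply: eq_bigr => i _; rewrite !mxE.
apply: (iffP idP) => [detA v vW v0 | W0].
  rewrite (coord_basis bW vW) big1 // => i _.
  suff /rowP/(_ i) : \row_k coord b k v = 0.
    by rewrite !mxE => ->; rewrite scale0r.
  apply/eqP; apply: contraNT detA => cN0; apply/det0P.
  exists (\row_k coord b k v) => //.
  apply/rowP => j; rewrite AE mxE -[RHS](v0 (enum_val j) (enum_valP j)).
  rewrite [in RHS](coord_basis bW vW); congr (fun_of_matrix _ _ _).
  by apply: eq_bigr => k _; rewrite mxE.
apply/det0P => -[c cN0 cA0]; case/eqP: cN0; apply/rowP => i; rewrite mxE.
have /freeP freeb := basis_free bW; apply: freeb; apply: W0 => [|k kI].
  apply: memv_suml => j _; apply/memvZ/(basis_mem bW).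
  by rewrite mem_nth // size_tuple.
by rewrite -(enum_rankK_in kI kI) -AE cA0 mxE.
Qed.

(** * Matroids of rank 1 and n-1 as nonempty sets *)

Definition rank1_support (n : nat) (M : matroid 1 n) : {set 'I_n} :=
  [set i | [set i] \in bases M].

Definition corank1_support (n : nat) (M : matroid n.-1 n) : {set 'I_n} :=
  [set i | ~: [set i] \in bases M].

Lemma matroidP (d n : nat) (M : matroid d n) : is_matroid d (bases M).
Proof. by case: M. Qed.

Lemma card_basis (d n : nat) (M : matroid d n) (I : {set 'I_n}) :
  I \in bases M -> #|I| = d.
Proof. by case/and3P: (matroidP M) => _ /forall_inP cardM _ /cardM/eqP. Qed.

Lemma card_setC1_ord (n : nat) (i : 'I_n) : #|~: [set i]| = n.-1.
Proof. by rewrite cardsC1 card_ord. Qed.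

Lemma card_pred_setC1 (n : nat) (I : {set 'I_n}) : (0 < n)%N -> #|I| = n.-1 ->
  exists i, I = ~: [set i].
Proof.
move=> n0 cardI; have /cards1P[i iE] : #|~: I| == 1%N.
  rewrite cardsCs finset.setCK card_ord cardI.
  by case: n n0 {I cardI} => // n _; rewrite subSnn.
by exists i; rewrite -iE finset.setCK.
Qed.

Lemma is_matroid_rank1 (n : nat) (S : {set 'I_n}) :
  S != finset.set0 -> is_matroid 1 [set [set i] | i in S].
Proof.
case/set0Pn => i0 i0S; apply/and3P; split.
- by apply/set0Pn; exists [set i0]; apply: imset_f.
- by apply/forall_inP => _ /imsetP[i _ ->]; rewrite cards1.
apply/forall_inP => _ /imsetP[a aS ->]; apply/forall_inP => _ /imsetP[b bS ->].
apply/forall_inP => i; rewrite !inE => /andP[ib /eqP ia]; subst i.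
apply/exists_inP; exists b; first by rewrite !inE eqxx eq_sym ib.
by rewrite finset.setDv finset.setU0 imset_f.
Qed.

Lemma is_matroid_corank1 (n : nat) (T : {set 'I_n}) :
  T != finset.set0 -> is_matroid n.-1 [set ~: [set i] | i in T].
Proof.
case/set0Pn => i0 i0T; apply/and3P; split.
- by apply/set0Pn; exists (~: [set i0]); apply: imset_f.
- by apply/forall_inP => _ /imsetP[i _ ->]; rewrite card_setC1_ord.
apply/forall_inP => _ /imsetP[a aT ->]; apply/forall_inP => _ /imsetP[b bT ->].
apply/forall_inP => i; rewrite !inE negbK => /andP[/eqP -> ab].
(* The only element of [~: [set a]] outside [~: [set b]] is [b]; exchanging it for [a] turns the
   first basis into the second. *)
apply/exists_inP; exists a; first by rewrite !inE eqxx eq_sym ab.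
suff -> : a |: (~: [set a] :\ b) = ~: [set b] by apply: imset_f.
apply/setP => k; rewrite !inE; case: (k =P a) => [->|_] /=.
  by rewrite eq_sym ab.
by rewrite andbT.
Qed.

Definition supports (n : nat) (M : plurimatroid n) : {set 'I_n} * {set 'I_n} :=
  (rank1_support M.1, corank1_support M.2).

(** A set of the wrong cardinality is never a basis, so membership of singletons, respectively of
    their complements, determines the matroid. *)
Lemma supports_inj (n : nat) : (0 < n)%N -> injective (@supports n).
Proof.
move=> n0 [M1 M2] [N1 N2] [/setP E1 /setP E2]; congr pair; apply/val_inj/setP => I.
  have [/eqP/cards1P[i ->]|cardI] := eqVneq #|I| 1%N.
    by have := E1 i; rewrite !inE.
  by apply/idP/idP => /card_basis/eqP; rewrite (negPf cardI).
have [/(card_pred_setC1 n0)[i ->]|cardI] := eqVneq #|I| n.-1.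
  by have := E2 i; rewrite !inE.
by apply/idP/idP => /card_basis/eqP; rewrite (negPf cardI).
Qed.

Lemma codom_supports (n : nat) (p : {set 'I_n} * {set 'I_n}) : (0 < n)%N ->
  (p \in codom (@supports n)) = (p.1 != finset.set0) && (p.2 != finset.set0).
Proof.
move=> n0; apply/codomP/andP => [[[M1 M2] ->] /= | [S0 T0]].
  split; apply/set0Pn.
    case/and3P: (matroidP M1) => /set0Pn[I IM] _ _.
    have /eqP/cards1P[i IE] := card_basis IM.
    by exists i; rewrite inE -IE.
  case/and3P: (matroidP M2) => /set0Pn[I IM] _ _.
  have [i IE] := card_pred_setC1 n0 (card_basis IM).
  by exists i; rewrite inE -IE.
exists (Matroid (is_matroid_rank1 S0), Matroid (is_matroid_corank1 T0)).
case: p S0 T0 => S T S0 T0; congr pair; apply/setP => i; rewrite inE /=; apply/esym.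
  exact: (mem_imset _ _ (@finset.set1_inj _)).
by apply: (mem_imset (f := fun i => ~: [set i])) => a b
  /finset.setC_inj/finset.set1_inj.
Qed.

(** [supports] is a bijection onto the pairs of nonempty sets, so counting plurimatroids by their
    supports amounts to counting pairs. *)
Lemma card_supports (n : nat) (P : pred ({set 'I_n} * {set 'I_n})) : (0 < n)%N ->
  #|[pred M : plurimatroid n | P (supports M)]|
  = #|[set p | [&& p.1 != finset.set0, p.2 != finset.set0 & P p]]|.
Proof.
move=> n0; rewrite -(card_image (supports_inj n0)) -cardsE; apply: eq_card => p.
rewrite !inE andbA -codom_supports //; apply/fintype.imageP/andP => [[M MP ->]|[]].
  by split=> //; apply: codom_f.
by case/codomP => M -> MP; exists M.
Qed.

(** * Thin Schubert cells of lines and hyperplanes *)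

Lemma thin_cell_line (F : fieldType) (n : nat) (M : matroid 1 n) (w : 'rV[F]_n) :
  thin_schubert_cell F M <[w]>%VS <->
  w != 0 /\ forall i, (w 0 i != 0) = (i \in rank1_support M).
Proof.
rewrite /thin_schubert_cell /grassmannian /= dim_vline.
have w1E i : w != 0 -> (plucker <[w]>%VS [set i] != 0) = (w 0 i != 0).
  move=> w0; apply/plucker_neq0P/idP => [|W0|wi0 _ /vlineP[c ->] /(_ i)].
  - by rewrite cards1 dim_vline w0.
  - apply: contraNneq w0 => wi0; apply/eqP/W0; first exact: memv_line.
    by move=> j; rewrite inE => /eqP ->.
  - rewrite inE eqxx mxE => /(_ isT)/eqP; rewrite mulf_eq0 (negPf wi0) orbF.
    by move/eqP ->; rewrite scale0r.
split=> -[w0 H].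
  have {}w0 : w != 0 by case: eqP w0.
  split=> // i; rewrite -w1E // inE; apply/idP/idP.
    by move/(H _ (cards1 i)).
  by move/(H _ (cards1 i)).
split=> [|I /eqP/cards1P[i ->]]; first by rewrite w0.
by rewrite w1E // H inE.
Qed.

(** A vector vanishing off [i] is a multiple of [delta_mx 0 i], so the Plücker coordinate at [~:
    [set i]] is nonzero exactly when [W] misses that basis vector. *)
Lemma thin_cell_hyperplane (F : fieldType) (n : nat) (M : matroid n.-1 n)
    (W : {vspace 'rV[F]_n}) : (0 < n)%N ->
  thin_schubert_cell F M W <->
  \dim W = n.-1 /\ forall i, (delta_mx 0 i \notin W) = (i \in corank1_support M).
Proof.
move=> n0; rewrite /thin_schubert_cell /grassmannian /=.
have WE i : \dim W = n.-1 ->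
    (plucker W (~: [set i]) != 0) = (delta_mx 0 i \notin W).
  move=> dimW; apply/plucker_neq0P/idP => [|W0|iW v vW v0].
  - by rewrite card_setC1_ord.
  - apply/negP => /W0 e0; have : delta_mx 0 i = 0 :> 'rV[F]_n.
      by apply: e0 => j; rewrite !inE mxE eqxx => /negPf ->.
    by move/rowP/(_ i)/eqP; rewrite !mxE !eqxx oner_eq0.
  have vE : v = v 0 i *: delta_mx 0 i.
    apply/rowP => j; rewrite !mxE eqxx /=; have [->|ji] := eqVneq j i.
      by rewrite mulr1.
    by rewrite mulr0 v0 // !inE.
  move: vW; rewrite vE; have [->|vi0] := eqVneq (v 0 i) 0; first by rewrite scale0r.
  by rewrite rpredZeq (negPf vi0) (negPf iW).
split=> -[dimW H]; split=> //.
  by move=> i; rewrite -WE // inE; apply/idP/idP => /(H _ (card_setC1_ord i)).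
by move=> I /(card_pred_setC1 n0)[i ->]; rewrite WE // H inE.
Qed.

Definition hyperplane (F : fieldType) (n : nat) (a : 'rV[F]_n) : {vspace 'rV[F]_n} :=
  lker (linfun (mulmxr a^T)).

Lemma mem_hyperplane (F : fieldType) (n : nat) (a v : 'rV[F]_n) :
  (v \in hyperplane a) = (\sum_i v 0 i * a 0 i == 0).
Proof.
rewrite memv_ker lfunE /=; have -> : v *m a^T = (\sum_i v 0 i * a 0 i)%:M.
  apply/rowP => j; rewrite ord1 !mxE eqxx mulr1n.
  by apply: eq_bigr => i _; rewrite mxE.
apply/eqP/eqP => [/matrixP/(_ 0 0)|->]; last by rewrite raddf0.
by rewrite !mxE eqxx mulr1n.
Qed.

Lemma delta_mem_hyperplane (F : fieldType) (n : nat) (a : 'rV[F]_n) i :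
  (delta_mx 0 i \in hyperplane a) = (a 0 i == 0).
Proof.
rewrite mem_hyperplane (bigD1 i) //= mxE !eqxx mul1r big1 ?addr0 // => j ji.
by rewrite mxE (negPf ji) andbF mul0r.
Qed.

Lemma dim_hyperplane (F : fieldType) (n : nat) (a : 'rV[F]_n) :
  a != 0 -> \dim (hyperplane a) = n.-1.
Proof.
case/rV0Pn => i ai0; set f : 'Hom('rV[F]_n, 'rV[F]_1) := linfun (mulmxr a^T).
have dimE m : \dim {: 'rV[F]_m} = m by rewrite dimvf; apply: mul1n.
have := limg_ker_dim f fullv; rewrite capfv dimE.
(* By rank-nullity it suffices that the form has rank one: its target is a line, and it does not
   kill [delta_mx 0 i]. *)
suff -> : \dim (limg f) = 1%N by rewrite addn1 => /(congr1 predn).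
apply/eqP; rewrite eqn_leq; apply/andP; split.
  by rewrite -[leqRHS]dimE; apply/dimvS/subvf.
rewrite lt0n dimv_eq0; apply: contraNneq ai0 => f0.
rewrite -delta_mem_hyperplane memv_ker -memv0 -f0.
by rewrite memv_img ?memvf.
Qed.

(** * Incidence when the supports share at most one element *)

Section FlagCells.
Variables (F : fieldType) (n : nat) (M : plurimatroid n).
Hypothesis n_gt0 : (0 < n)%N.
Let S := (supports M).1.
Let T := (supports M).2.

Lemma cell_productP (W : {vspace 'rV[F]_n} * {vspace 'rV[F]_n}) :
  cell_product F M W <->
  exists w, [/\ W.1 = <[w]>%VS, w != 0, forall i, (w 0 i != 0) = (i \in S),
    \dim W.2 = n.-1 & forall i, (delta_mx 0 i \notin W.2) = (i \in T)].
Proof.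
case: W => W1 W2; split=> /= [[/= W1M /(thin_cell_hyperplane _ _ n_gt0)[dimW2 W2T]]|].
  exists (vpick W1); have [dimW1 _] := W1M.
  have w0 : vpick W1 != 0 by rewrite vpick0 -dimv_eq0 dimW1.
  have W1E : W1 = <[vpick W1]>%VS.
    by apply/esym/eqP; rewrite eqEdim -memvE memv_pick dimW1 dim_vline w0.
  by move: W1M; rewrite {1}W1E => /thin_cell_line[_ W1S].
case=> w [-> w0 wS dimW2 W2T]; split=> /=; first exact/thin_cell_line.
exact/thin_cell_hyperplane.
Qed.

(** The cells already impose the dimensions, so only the inclusion remains. *)
Lemma flag_cellP (W : {vspace 'rV[F]_n} * {vspace 'rV[F]_n}) :
  flag_cell F M W <-> cell_product F M W /\ (W.1 <= W.2)%VS.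
Proof.
split=> [[? []] //|[WM W12]]; split=> //; split=> //; first by case: WM => -[].
by case: WM => _ [].
Qed.

(** The line is spanned by a combination of basis vectors indexed by [S], and all of these lie in
    the hyperplane because their indices avoid [T]. *)
Lemma disjoint_supports_complete : [disjoint S & T] -> complete_cell F M.
Proof.
move=> dST; apply/seteqP; split=> W; first by move/flag_cellP => [].
move=> WM; apply/flag_cellP; split=> //.
case/cell_productP: WM => w [-> w0 wS _ WT].
rewrite -memvE (row_sum_delta w); apply: memv_suml => i _.
have [->|wi0] := eqVneq (w 0 i) 0; first by rewrite scale0r mem0v.
by apply: memvZ; apply: negbNE; rewrite WT (disjointFr dST) // -wS.
Qed.

(* A single monomial in the incidence equation is nonzero, so the equation has
   no solution. *)
Lemma single_common_support_empty : #|S :&: T| = 1%N -> empty_cell F M.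
Proof.
move=> /eqP/cards1P[k STk]; apply/seteqP; split=> W //.
case/flag_cellP => /cell_productP[w [-> w0 wS _ WT]].
have /setIP[kS kT] : k \in S :&: T by rewrite STk inE.
have w0i i : i != k -> w 0 i != 0 -> delta_mx 0 i \in W.2.
  move=> ik; rewrite wS => iS; apply: negbNE; rewrite WT.
  by apply: contra ik => iT; rewrite -(finset.in_set1 i k) -STk inE iS.
have /negPf kW : delta_mx 0 k \notin W.2 by rewrite WT.
(* All terms of [w] but the one at [k] lie in [W.2], so [w] lies there only if the term at [k]
   does. *)
rewrite -memvE (row_sum_delta w) (bigD1 k) //= rpredDr.
  by rewrite rpredZeq kW orbF; apply/negP; rewrite wS.
apply: memv_suml => i ik.
have [->|wi0] := eqVneq (w 0 i) 0; first by rewrite scale0r mem0v.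
exact/memvZ/w0i.
Qed.

End FlagCells.

Lemma mem_cell_product_hyperplane (F : fieldType) (n : nat) (M : plurimatroid n)
    (w a : 'rV[F]_n) : (0 < n)%N ->
  (forall i, (w 0 i != 0) = (i \in (supports M).1)) ->
  (forall i, (a 0 i != 0) = (i \in (supports M).2)) ->
  cell_product F M (<[w]>%VS, hyperplane a).
Proof.
move=> n0 wS aT; apply/cell_productP => //; exists w.
(* Supports of a plurimatroid are nonempty, which makes [w] and [a] nonzero. *)
have := codom_f (@supports n) M.
rewrite codom_supports // => /andP[/set0Pn[i iS] /set0Pn[j jT]].
split=> //=.
- by apply/rV0Pn; exists i; rewrite wS.
- by apply: dim_hyperplane; apply/rV0Pn; exists j; rewrite aT.
- by move=> k; rewrite delta_mem_hyperplane aT.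
Qed.

(** * Points of the cells in characteristic 0 *)

Section FlagCellsChar0.
Variables (F : numFieldType) (n : nat) (M : plurimatroid n).
Hypothesis n_gt0 : (0 < n)%N.
Let S := (supports M).1.
Let T := (supports M).2.

(** A vector with prescribed support; pairing two of these counts the intersection, and in
    characteristic 0 this vanishes only when the intersection is empty. *)
Definition indicator (A : {set 'I_n}) : 'rV[F]_n := \row_i (i \in A)%:R.

Lemma indicator_neq0 (A : {set 'I_n}) i : (indicator A 0 i != 0) = (i \in A).
Proof. by rewrite mxE pnatr_eq0 eqb0 negbK. Qed.

Lemma indicator_dot (A B : {set 'I_n}) :
  \sum_i indicator A 0 i * indicator B 0 i = #|A :&: B|%:R.
Proof.
rewrite -sum1_card natr_sum [RHS]big_mkcond; apply: eq_bigr => i _.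
by rewrite !mxE inE -natrM mulnb; case: (_ && _).
Qed.

Lemma cell_product_neq0 : (cell_product F M !=set0)%classic.
Proof.
exists (<[indicator S]>%VS, hyperplane (indicator T)).
by apply: mem_cell_product_hyperplane => // i; rewrite indicator_neq0.
Qed.

Lemma many_common_supports_proper : (1 < #|S :&: T|)%N -> proper_cell F M.
Proof.
move=> ST2; have /set0Pn[k] : S :&: T != finset.set0 by rewrite -card_gt0 ltnW.
case/setIP => kS kT; split.
  (* Lowering the weight at k makes the incidence equation hold; in
     characteristic 0 the new weight 1 - #|S :&: T| is still nonzero. *)
  pose a := indicator T - #|S :&: T|%:R *: delta_mx 0 k.
  exists (<[indicator S]>%VS, hyperplane a); apply/flag_cellP; split=> /=.
    apply: mem_cell_product_hyperplane => // i; first by rewrite indicator_neq0.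
    rewrite !mxE eqxx /=; have [->|_] := eqVneq i k.
      by rewrite kT mulr1 subr_eq0 eqr_nat eq_sym neq_ltn ST2 orbT.
    by rewrite mulr0 subr0 pnatr_eq0 eqb0 negbK.
  rewrite -memvE mem_hyperplane.
  under eq_bigr => i _ do rewrite [a 0 i]mxE mulrDr.
  rewrite big_split /= indicator_dot (bigD1 k) //= big1 => [|i ik].
    by rewrite !mxE !eqxx kS mul1r mulr1 addr0 subrr.
  by rewrite !mxE (negPf ik) andbF mulr0 oppr0 mulr0.
(* The inclusion is strict: the pair given by the two indicators has incidence sum [#|S :&: T|],
   which is nonzero. *)
split=> [W /flag_cellP[] //|/(_ (<[indicator S]>%VS, hyperplane (indicator T)))].
case/(_ _)/flag_cellP => [|_ /=].
  by apply: mem_cell_product_hyperplane => // i; rewrite indicator_neq0.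
by rewrite -memvE mem_hyperplane indicator_dot pnatr_eq0 -leqn0 leqNgt ltnW.
Qed.

(** As the product of cells is nonempty, the three properties exclude one another. The implications
    from the three possible sizes of [S :&: T] therefore become equivalences. *)
Lemma cell_trichotomy :
  [/\ `[< complete_cell F M >] = (#|S :&: T| == 0%N),
      `[< proper_cell F M >] = (1 < #|S :&: T|)%N
    & `[< empty_cell F M >] = (#|S :&: T| == 1%N)].
Proof.
have [W0 W0M] := cell_product_neq0.
have completeNempty : complete_cell F M -> ~ empty_cell F M.
  by rewrite /complete_cell /empty_cell => -> M0; rewrite M0 in W0M.
have properNcomplete : proper_cell F M -> ~ complete_cell F M.
  by move=> [_ [_ prod_sub]] cM; apply: prod_sub; rewrite cM.
have properNempty : proper_cell F M -> ~ empty_cell F M.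
  by move=> [[W WM] _]; rewrite /empty_cell => M0; rewrite M0 in WM.
case cardST: #|S :&: T| => [|[|m]] /=.
- have cM : complete_cell F M.
    by apply: disjoint_supports_complete; rewrite // -setI_eq0 -cards_eq0 cardST.
  by split; apply/asboolP => //; [move/properNcomplete | apply: completeNempty].
- have eM : empty_cell F M by apply: single_common_support_empty.
  by split; apply/asboolP => //; [move/completeNempty | move/properNempty].
- have pM : proper_cell F M by apply: many_common_supports_proper; rewrite cardST.
  by split; apply/asboolP => //; [apply: properNcomplete | apply: properNempty].
Qed.

End FlagCellsChar0.

(** * Counting pairs of sets by the size of their intersection *)

Section CountingPairs.
Variable n : nat.
Let pairs : finType := ({set 'I_n} * {set 'I_n})%type.

Lemma cards_sum (Q : pred pairs) : #|[set p : pairs | Q p]| = (\sum_p Q p)%N.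
Proof. by rewrite -sum1dep_card big_mkcond; apply: eq_bigr => p _; case: (Q p). Qed.

(** A pair of sets is a function sending each element to its two membership bits; a condition
    imposed elementwise leaves independent choices. *)
Lemma card_set_pairs_prod (F : 'I_n -> pred (bool * bool))
    (Q : pred pairs) :
  (forall p, Q p = [forall i, F i (i \in p.1, i \in p.2)]) ->
  #|[set p : pairs | Q p]| = (\prod_i #|F i|)%N.
Proof.
move=> QE; pose h (p : pairs) := [ffun i => (i \in p.1, i \in p.2)].
pose h' (g : {ffun 'I_n -> bool * bool}) : pairs := ([set i | (g i).1], [set i | (g i).2]).
have hK : cancel h h'.
  by case=> A B; congr pair; apply/setP => i; rewrite inE ffunE.
have h'K : cancel h' h.
  by move=> g; apply/ffunP => i; rewrite ffunE !inE; case: (g i).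
transitivity #|(family F : simpl_pred {ffun 'I_n -> bool * bool})|; last first.
  by rewrite card_family foldrE big_image.
rewrite -(card_image (can_inj hK)); apply: eq_card => g; rewrite -[in LHS](h'K g).
rewrite (fintype.mem_image (can_inj hK)) inE QE.
by apply/forallP/familyP => gF i; have := gF i; rewrite !inE -surjective_pairing.
Qed.

Lemma card_disjoint_pairs : #|[set p : pairs | #|p.1 :&: p.2| == 0%N]| = (3 ^ n)%N.
Proof.
(* Of the four membership patterns only belonging to both sets is excluded. *)
rewrite (card_set_pairs_prod (F := fun=> [pred x | x != (true, true)])) => [|[A B]].
  by rewrite prod_nat_const card_ord cardC1 card_prod card_bool.
rewrite cards_eq0 setI_eq0 /=; apply/pred0P/forallP => [AB i | AB i] /=.
  by have := AB i; rewrite /= xpair_eqE !eqb_id => ->.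
by have := AB i; rewrite /= xpair_eqE !eqb_id => /negPf.
Qed.

Lemma card_pairs_setI1 (k : 'I_n) :
  #|[set p : pairs | p.1 :&: p.2 == [set k]]| = (3 ^ n.-1)%N.
Proof.
(* The element [k] has one allowed pattern, every other element three. *)
rewrite (card_set_pairs_prod
  (F := fun i => [pred x | (x == (true, true)) == (i == k)])) => [|[A B]].
  rewrite (bigD1 k) //= (eq_bigr (fun=> 3%N)) => [|i /negPf ik].
    rewrite prod_nat_const cardC1 card_ord (eq_card (B := pred1 (true, true))).
      by rewrite card1 mul1n.
    by move=> x; rewrite !inE eqxx eqb_id.
  rewrite (eq_card (B := predC1 (true, true))).
    by rewrite cardC1 card_prod card_bool.
  by move=> x; rewrite !inE ik eqbF_neg.
apply/eqP/forallP => [/setP AB i | AB] /=.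
  by have := AB i; rewrite !inE /= xpair_eqE !eqb_id => ->.
by apply/setP => i; have := AB i; rewrite !inE /= xpair_eqE !eqb_id => /eqP.
Qed.

Lemma card_single_intersection_pairs :
  #|[set p : pairs | #|p.1 :&: p.2| == 1%N]| = (n * 3 ^ n.-1)%N.
Proof.
(* The pairs are split by their common element [k], and the sums are exchanged. *)
have card1E (A : {set 'I_n}) : (#|A| == 1 :> nat) = (\sum_k (A == [set k]))%N :> nat.
  case: (boolP (_ == _)) => [/cards1P[k ->]|A1].
    rewrite (bigD1 k) //= eqxx big1 // => j jk.
    by rewrite (inj_eq (@finset.set1_inj _)) eq_sym (negPf jk).
  rewrite big1 // => k _; apply/eqP; rewrite eqb0.
  by apply: contra A1 => /eqP ->; rewrite cards1.
rewrite cards_sum; under eq_bigr do rewrite card1E.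
transitivity (\sum_(k < n) 3 ^ n.-1)%N; last by rewrite sum_nat_const card_ord.
rewrite exchange_big /=.
by apply: eq_bigr => k _; rewrite -(card_pairs_setI1 k) cards_sum.
Qed.

(** Pairs with an empty component are all disjoint; by inclusion-exclusion there are [2 ^ n.+1 - 1]
    of them, since the pair of two empty sets is counted twice. *)
Lemma card_nonempty_disjoint_pairs :
  (#|[set p : pairs | [&& p.1 != finset.set0, p.2 != finset.set0 & #|p.1 :&: p.2| == 0%N]]|
   + 2 ^ n.+1 = 3 ^ n + 1)%N.
Proof.
pose L : {set pairs} := finset.setX [set finset.set0] finset.setT.
pose R : {set pairs} := finset.setX finset.setT [set finset.set0].
have cardT : #|[set: {set 'I_n}]| = (2 ^ n)%N.
  by rewrite -powersetT card_powerset cardsT card_ord.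
have cardLR : (#|L :|: R| + 1 = 2 ^ n.+1)%N.
  have LR1 : #|L :&: R| = 1%N.
    rewrite -(cards1 ((finset.set0, finset.set0) : pairs)).
    by apply: eq_card => -[A B]; rewrite !inE /= andbT -xpair_eqE.
  by rewrite -[X in (_ + X)%N]LR1 cardsUI !cardsX cards1 cardT mul1n muln1 addnn -mul2n expnS.
rewrite -card_disjoint_pairs -(cardsID (L :|: R) [set p : pairs | #|p.1 :&: p.2| == 0%N]).
rewrite -cardLR addnA; congr (_ + _)%N; rewrite addnC; congr (_ + _)%N.
  apply: eq_card => -[A B]; rewrite !inE /= andbT.
  apply/idP/andP => [|[] //] AB; split=> //.
  by case/orP: AB => /eqP ->; rewrite ?finset.set0I ?finset.setI0 cards0.
by apply: eq_card => -[A B]; rewrite !inE /= andbT negb_or andbA.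
Qed.

Lemma card_nonempty_single_intersection_pairs :
  #|[set p : pairs | [&& p.1 != finset.set0, p.2 != finset.set0 & #|p.1 :&: p.2| == 1%N]]|
  = (n * 3 ^ n.-1)%N.
Proof.
rewrite -card_single_intersection_pairs; apply: eq_card => -[A B]; rewrite !inE /=.
apply/and3P/idP => [[] //|AB]; split=> //; apply: contraL AB => /eqP ->.
  by rewrite finset.set0I cards0.
by rewrite finset.setI0 cards0.
Qed.

Lemma card_nonempty_multiple_intersection_pairs :
  (#|[set p : pairs | [&& p.1 != finset.set0, p.2 != finset.set0 & 1 < #|p.1 :&: p.2|]]|
   + n * 3 ^ n.-1 + 3 ^ n = 4 ^ n)%N.
Proof.
have <- : (\sum_(p : pairs) 1 = 4 ^ n)%N.
  by rewrite sum1_card card_prod -!cardsT -powersetT card_powerset cardsT card_ord -expnMn.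
rewrite -card_single_intersection_pairs -card_disjoint_pairs.
rewrite !cards_sum -!big_split /=.
(* Each pair satisfies exactly one of the three conditions, since an intersection of size at least
   two forces both sets to be nonempty. *)
apply: eq_bigr => -[A B] _ /=; have [->|A0] := eqVneq A finset.set0.
  by rewrite finset.set0I cards0.
have [->|B0] := eqVneq B finset.set0; first by rewrite finset.setI0 cards0.
by case: #|_| => [|[|m]].
Qed.

End CountingPairs.

Theorem corollary5p8 (R : realType) (n : nat) (hn : (3 <= n)%N) :
  [/\ #|[pred M : plurimatroid n | `[< complete_cell R[i] M >]]|%:Z
        = 3 ^+ n - 2 ^+ n.+1 + 1,
      #|[pred M : plurimatroid n | `[< proper_cell R[i] M >]]|%:Z
        = 4 ^+ n - 3 ^+ n - n%:Z * 3 ^+ n.-1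
    & #|[pred M : plurimatroid n | `[< empty_cell R[i] M >]]|%:Z
        = n%:Z * 3 ^+ n.-1].
Proof.
have n0 : (0 < n)%N by apply: leq_trans hn.
split.
- rewrite (eq_card (B := [pred M : plurimatroid n |
    #|(supports M).1 :&: (supports M).2| == 0%N])) => [|M]; last first.
    by rewrite !inE; case: (cell_trichotomy R[i] M n0).
  rewrite (card_supports (fun p => #|p.1 :&: p.2| == 0%N) n0).
  (* The additive identity over [nat] is cast to integers before terms are moved across. *)
  have /(congr1 Posz) := card_nonempty_disjoint_pairs n.
  rewrite !PoszD -!natz !natrX => /(canRL (addrK _)) ->.
  by rewrite addrAC.
- rewrite (eq_card (B := [pred M : plurimatroid n |
    (1 < #|(supports M).1 :&: (supports M).2|)%N])) => [|M]; last first.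
    by rewrite !inE; case: (cell_trichotomy R[i] M n0).
  rewrite (card_supports (fun p => 1 < #|p.1 :&: p.2|)%N n0).
  have /(congr1 Posz) := card_nonempty_multiple_intersection_pairs n.
  rewrite !PoszD PoszM -!natz !natrX => /(canRL (addrK _))/(canRL (addrK _)) ->.
  by [].
rewrite (eq_card (B := [pred M : plurimatroid n |
  #|(supports M).1 :&: (supports M).2| == 1%N])) => [|M]; last first.
  by rewrite !inE; case: (cell_trichotomy R[i] M n0).
rewrite (card_supports (fun p => #|p.1 :&: p.2| == 1%N) n0).
by rewrite card_nonempty_single_intersection_pairs PoszM -!natz natrX.
Qed.
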